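(* For each integer $2\leqslant n\leqslant 450$, the inequality \[f_n(s)\leqslant 2e^2 c_n^{\,n-1}h(s)\] holds for all $s\geqslant 1$ if $n$ is odd and for all $s\geqslant 2$ if $n$ is even, where $c_n$ is given by: $c_2=0.33$, $c_3=0.39$, $c_4=0.45$, $c_5=0.51$, $c_6=0.54$, $c_7=0.57$, $c_8=0.58$, $c_9=c_{10}=0.61$, $c_n=0.63$ for $n=11,12$, $c_{13}=0.64$, $c_{14}=0.65$, $c_n=0.66$ for $15\leqslant n\leqslant 18$, $c_n=0.67$ for $19\leqslant n\leqslant 20$, $c_n=0.68$ for $21\leqslant n\leqslant 24$, $c_n=0.69$ for $25\leqslant n\leqslant 32$, $c_n=0.70$ for $33\leqslant n\leqslant 46$, $c_n=0.71$ for $47\leqslant n\leqslant 80$, $c_n=0.72$ for $81\leqslant n\leqslant 308$, and $c_n=0.73$ for $309\leqslant n\leqslant 450$.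
   Context: $h(s)=e^{-2}$ for $1\leqslant s\leqslant 2$, $h(s)=e^{-s}$ for $2\leqslant s\leqslant 3$, $h(s)=3s^{-1}e^{-s}$ for $s\geqslant3$. The functions $f_n$ are defined by: $f_1(s)=(3-s)/s$ for $1\leqslant s\leqslant 3$ and $f_1(s)=0$ for $s>3$; for $n\geqslant 2$, if $n$ is even and $s\geqslant2$, or $n$ is odd and $s\geqslant3$, then $sf_n(s)=\int_s^\infty f_{n-1}(t-1)\,dt$; if $n$ is odd and $1\leqslant s\leqslant 3$ then $sf_n(s)=3f_n(3)$. *)

(* Defs.v *)
From Stdlib Require Import Reals.
From Coquelicot Require Import Coquelicot.

Open Scope R_scope.

(* Only used for s >= 1. *)
Definition h (s : R) : R :=
  if Rle_dec s 2 then exp (- 2)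
  else if Rle_dec s 3 then exp (- s)
  else 3 * / s * exp (- s).

Definition tail_integral (g : R -> R) (s : R) : R :=
  RInt_gen (fun t => g (t - 1)) (at_point s) (Rbar_locally p_infty).

Definition f_one (s : R) : R :=
  if Rlt_dec s 1 then 0
  else if Rle_dec s 3 then (3 - s) / s
  else 0.

Definition f_even (g : R -> R) (s : R) : R :=
  if Rlt_dec s 2 then 0 else tail_integral g s / s.

(* For 1 <= s <= 3 this is 3 f_n(3) / s, where 3 f_n(3) is the integral at s = 3. *)
Definition f_odd (g : R -> R) (s : R) : R :=
  if Rlt_dec s 1 then 0
  else if Rle_dec s 3 then 3 * (tail_integral g 3 / 3) / s
  else tail_integral g s / s.

(* The n-th function has natural domain s >= 1 for n odd and s >= 2 for n even;
   it is extended by 0 to the left of it.  The integrals defining it only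
   evaluate the previous function on its natural domain.  All
   functions are continuous on that domain and vanish for s > n + 2, so these
   improper integrals converge.  Index 0 is unused. *)
Fixpoint fn (n : nat) : R -> R :=
  match n with
  | O => fun _ => 0
  | S O => f_one
  | S m => if Nat.even n then f_even (fn m) else f_odd (fn m)
  end.

(* Only used for 2 <= n <= 450. *)
Definition cn (n : nat) : R :=
  if (n <=? 2)%nat then 0.33
  else if (n <=? 3)%nat then 0.39
  else if (n <=? 4)%nat then 0.45
  else if (n <=? 5)%nat then 0.51
  else if (n <=? 6)%nat then 0.54
  else if (n <=? 7)%nat then 0.57
  else if (n <=? 8)%nat then 0.58
  else if (n <=? 10)%nat then 0.61
  else if (n <=? 12)%nat then 0.63
  else if (n <=? 13)%nat then 0.64
  else if (n <=? 14)%nat then 0.65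
  else if (n <=? 18)%nat then 0.66
  else if (n <=? 20)%nat then 0.67
  else if (n <=? 24)%nat then 0.68
  else if (n <=? 32)%nat then 0.69
  else if (n <=? 46)%nat then 0.70
  else if (n <=? 80)%nat then 0.71
  else if (n <=? 308)%nat then 0.72
  else 0.73.

(* Main.v *)
Require Import Defs.
From Stdlib Require Import Reals Lra Lia ZArith List Bool.
From Coquelicot Require Import Coquelicot.
Open Scope R_scope.

(* With G_n(s) = s f_n(s), the recursion reads G_n(s) = int_(s-1)^oo f_(n-1).
   By induction G_n is nonnegative, decreasing, and convex on each side of 3;
   dividing by s, so is f_n.  Hence chords lie above f_(n-1), and the trapezoid
   rule on the grid k/16, for which 3 is a grid point, turns upper bounds of
   f_(n-1) at the grid points of [1,8] into upper bounds of f_n there.  Beyond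
   s = 8 a bound C e^(8-s) for G_n is propagated.  All this is integer arithmetic
   with upward rounding, run for n <= 450, where f_n is scaled by
   2^40 (4/3)^(n-1) to compensate for its decay.  The grid bounds are compared
   with the envelope e_k obtained from e_32 = 2 c_n^(n-1) (scaled) by
   e_(k+1) = (15/16) e_k: the chord joining e_k to e_(k+1) is the tangent at k/16
   of e_k exp(k/16 - s), which makes the comparison valid between grid points. *)

(** * The class of functions preserved by the recursion *)

(** Integrability and eventual vanishing reduce the improper integrals to ordinary ones. The chord
    inequality excludes intervals straddling 3 because for odd n >= 3 the function s f_n(s) is
    constant up to 3 and decreases afterwards, which is not convex across 3. *)
Record tame (d : R) (f : R -> R) : Prop := {
  tame_int : forall x y, d <= x <= y -> ex_RInt f x y;
  tame_ge0 : forall s, d <= s -> 0 <= s * f s;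
  tame_decr : forall x y, d <= x <= y -> y * f y <= x * f x;
  tame_chord : forall x t y, d <= x <= t -> t <= y -> y <= 3 \/ 3 <= x ->
    (y - x) * (t * f t) <= (y - t) * (x * f x) + (t - x) * (y * f y);
  tame_supp : exists b, forall s, b <= s -> f s = 0 }.

Lemma tame_pos (d : R) (f : R -> R) (s : R) :
  0 < d -> tame d f -> d <= s -> 0 <= f s.
Proof.
intros hd hf hs. pose proof (tame_ge0 _ _ hf s hs). nra.
Qed.

Lemma tame_antitone (d : R) (f : R -> R) (x y : R) :
  0 < d -> tame d f -> d <= x <= y -> f y <= f x.
Proof.
intros hd hf hxy.
pose proof (tame_decr _ _ hf x y hxy).
assert (0 <= f y) by (apply (tame_pos d); lra || assumption).
nra.
Qed.

(* Chebyshev: of the two factors s * f s and / s of f s, both are convex and decreasing. *)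
Lemma tame_chord_fun (d : R) (f : R -> R) (x t y : R) :
  0 < d -> tame d f -> d <= x <= t -> t <= y -> y <= 3 \/ 3 <= x ->
  (y - x) * f t <= (y - t) * f x + (t - x) * f y.
Proof.
intros hd hf hxt hty hc.
pose proof (tame_chord _ _ hf x t y hxt hty hc) as H.
assert (hdec : y * f y <= x * f x) by (apply (tame_decr _ _ hf); lra).
apply Rmult_le_reg_l with t; [lra|].
(* [E] is exactly the excess of t times the chord of f over the chord of s f(s). *)
assert (E : (y - t) * (t - x) * (f x - f y) >= 0).
{ apply Rle_ge. apply Rmult_le_pos; [apply Rmult_le_pos; lra|].
  assert (f y <= f x) by (apply (tame_antitone d); try lra; assumption). lra. }
nra.
Qed.

(** * Tail integrals of tame functions *)

(** Substituting t - 1 turns the tail integral at x + 1 into the integral of f from x on, and this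
    can be cut off at any c beyond the support. *)
Lemma tail_integral_eq (d : R) (f : R -> R) (b x c : R) :
  tame d f -> (forall s, b <= s -> f s = 0) -> d <= x -> x <= c -> b <= c ->
  is_RInt f x c (tail_integral f (x + 1)).
Proof.
intros hf hb hx hxc hbc.
destruct (tame_int _ _ hf x c) as [l hl]; [lra|].
replace (tail_integral f (x + 1)) with l; [exact hl|].
symmetry. unfold tail_integral.
apply (is_RInt_gen_unique (fun t => f (t - 1))).
intros P HP.
apply (Filter_prod _ _ _ (fun u => u = x + 1) (fun v => c + 1 < v)).
- reflexivity.
(* An upper limit v > c + 1 becomes v - 1 > c after the shift, so the extra piece from c to v - 1
   contributes 0. *)
- exists (c + 1). auto.
- intros u v -> hv. exists l. split; [|apply locally_singleton; exact HP].
  cbn [fst snd].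
  apply (is_RInt_ext (fun t => scal 1 (f (1 * t + -1)))).
  { intros t _. change (1 * f (1 * t + -1) = f (t - 1)). rewrite Rmult_1_l. f_equal. ring. }
  apply (is_RInt_comp_lin f 1 (-1) (x + 1) v l).
  replace (1 * (x + 1) + -1) with x by ring.
  rewrite <- (Rplus_0_r l).
  apply (is_RInt_Chasles f x c (1 * v + -1) l 0 hl).
  apply (is_RInt_ext (fun _ => 0)).
  { intros t. rewrite Rmin_left by lra. intros ht. symmetry. apply hb. lra. }
  pose proof (is_RInt_const c (1 * v + -1) 0) as H0.
  change (scal (1 * v + -1 - c) 0) with ((1 * v + -1 - c) * 0) in H0.
  rewrite Rmult_0_r in H0. exact H0.
Qed.

Lemma tail_integral_supp (d : R) (f : R -> R) :
  tame d f -> exists b, d <= b /\ forall x, b <= x -> tail_integral f (x + 1) = 0.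
Proof.
intros hf. destruct (tame_supp _ _ hf) as [b hb].
exists (Rmax b d). split; [apply Rmax_r|]. intros x hx.
pose proof (Rmax_l b d). pose proof (Rmax_r b d).
rewrite <- (is_RInt_unique _ _ _ _ (tail_integral_eq d f b x x hf hb ltac:(lra) ltac:(lra) ltac:(lra))).
apply is_RInt_unique, (is_RInt_point f x).
Qed.

Lemma tail_integral_diff (d : R) (f : R -> R) (x y : R) :
  tame d f -> d <= x <= y ->
  is_RInt f x y (tail_integral f (x + 1) - tail_integral f (y + 1)).
Proof.
intros hf hxy. destruct (tame_supp _ _ hf) as [b hb].
pose proof (Rmax_l b y). pose proof (Rmax_r b y).
pose proof (tail_integral_eq d f b x (Rmax b y) hf hb ltac:(lra) ltac:(lra) ltac:(lra)) as Hx.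
pose proof (tail_integral_eq d f b y (Rmax b y) hf hb ltac:(lra) ltac:(lra) ltac:(lra)) as Hy.
apply (is_RInt_Chasles _ _ _ _ _ _ Hx (is_RInt_swap _ _ _ _ Hy)).
Qed.

Lemma tail_integral_le (d : R) (f : R -> R) (x y : R) (Q q : R -> R) :
  tame d f -> d <= x <= y ->
  (forall t, is_derive Q t (q t)) -> (forall t, continuous q t) ->
  (forall t, x < t < y -> f t <= q t) ->
  tail_integral f (x + 1) - tail_integral f (y + 1) <= Q y - Q x.
Proof.
intros hf hxy hQ hq hle.
apply (is_RInt_le f q x y); [lra| |apply (is_RInt_derive Q q); auto|exact hle].
apply (tail_integral_diff d); assumption.
Qed.

Lemma tail_integral_bounds (d : R) (f : R -> R) (x y : R) :
  0 < d -> tame d f -> d <= x <= y ->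
  (y - x) * f y <= tail_integral f (x + 1) - tail_integral f (y + 1) <= (y - x) * f x.
Proof.
intros hd hf hxy. pose proof (tail_integral_diff d f x y hf hxy) as H. split.
- apply (is_RInt_le (fun _ => f y) f x y); [lra|apply (is_RInt_const x y (f y))|exact H|].
  intros t ht. apply (tame_antitone d); try assumption; lra.
- apply (is_RInt_le f (fun _ => f x) x y); [lra|exact H|apply (is_RInt_const x y (f x))|].
  intros t ht. apply (tame_antitone d); try assumption; lra.
Qed.

Lemma tail_integral_ge0 (d : R) (f : R -> R) (x : R) :
  0 < d -> tame d f -> d <= x -> 0 <= tail_integral f (x + 1).
Proof.
intros hd hf hx. destruct (tail_integral_supp d f hf) as [b [hdb hb]].
pose proof (Rmax_l b x). pose proof (Rmax_r b x).
pose proof (tail_integral_bounds d f x (Rmax b x) hd hf ltac:(lra)) as [H1 _].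
assert (0 <= f (Rmax b x)) by (apply (tame_pos d); lra || assumption).
rewrite (hb (Rmax b x)) in H1 by lra. nra.
Qed.

Lemma tail_integral_decr (d : R) (f : R -> R) (x y : R) :
  0 < d -> tame d f -> d <= x <= y -> tail_integral f (y + 1) <= tail_integral f (x + 1).
Proof.
intros hd hf hxy.
pose proof (tail_integral_bounds d f x y hd hf hxy) as [H1 _].
assert (0 <= f y) by (apply (tame_pos d); lra || assumption). nra.
Qed.

Lemma tail_integral_trapezoid (d : R) (f : R -> R) (x y : R) :
  0 < d -> tame d f -> d <= x < y -> y <= 3 \/ 3 <= x ->
  tail_integral f (x + 1) - tail_integral f (y + 1) <= (y - x) / 2 * (f x + f y).
Proof.
intros hd hf hxy hc.
(* [m] is the slope of the chord of f over [x,y], and [Q] an antiderivative of that chord. *)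
set (m := (f y - f x) / (y - x)).
set (Q := fun t => f x * t + m * (t - x) ^ 2 / 2).
replace ((y - x) / 2 * (f x + f y)) with (Q y - Q x) by (unfold Q, m; field; lra).
apply (tail_integral_le d f x y Q (fun t => f x + m * (t - x))); try assumption; try lra.
- intros t. unfold Q. auto_derive; [exact I|]. field.
- intros t. apply (@ex_derive_continuous R_AbsRing R_NormedModule). auto_derive. exact I.
- intros t ht.
  pose proof (tame_chord_fun d f x t y hd hf ltac:(lra) ltac:(lra) hc).
  apply Rmult_le_reg_l with (y - x); [lra|].
  replace ((y - x) * (f x + m * (t - x))) with ((y - t) * f x + (t - x) * f y); [assumption|].
  unfold m. field. lra.
Qed.

(** For t >= b the factor 1/t is at most 1/b, which leaves a pure exponential to integrate. The
    upper limit is taken beyond the support of f, and its exponential term is dropped by sign. *)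
Lemma tail_integral_exp (d : R) (f : R -> R) (A b x : R) :
  tame d f -> d <= x -> 0 < b <= x -> 0 <= A ->
  (forall s, b <= s -> s * f s <= A * exp (b - s)) ->
  tail_integral f (x + 1) <= A / b * exp (b - x).
Proof.
intros hf hd hbx hA hle. destruct (tail_integral_supp d f hf) as [c [_ hc]].
pose proof (Rmax_l c x). pose proof (Rmax_r c x). set (y := Rmax c x) in *.
set (Q := fun t => - (A / b) * exp (b - t)).
assert (tail_integral f (x + 1) - tail_integral f (y + 1) <= Q y - Q x) as H1.
{ apply (tail_integral_le d f x y Q (fun t => A / b * exp (b - t))); try assumption; try lra.
  - intros t. unfold Q. auto_derive; [exact I|]. unfold Rminus. ring.
  - intros t. apply (@ex_derive_continuous R_AbsRing R_NormedModule). auto_derive. exact I.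
  - intros t ht.
    pose proof (hle t ltac:(lra)) as H2. pose proof (exp_pos (b - t)) as He.
    apply Rmult_le_reg_l with t; [lra|].
    apply Rle_trans with (1 := H2).
    apply Rmult_le_reg_l with b; [lra|].
    replace (b * (t * (A / b * exp (b - t)))) with (t * (A * exp (b - t))) by (field; lra).
    apply Rmult_le_compat_r; [|lra]. apply Rmult_le_pos; lra. }
unfold Q in H1. rewrite (hc y) in H1 by lra.
assert (0 <= A / b) by (apply Rdiv_le_0_compat; lra).
pose proof (exp_pos (b - y)). nra.
Qed.

(** * Tameness passes along the recursion *)

Lemma lipschitz_continuous (g : R -> R) (L : R) :
  (forall x y, x <= y -> Rabs (g y - g x) <= L * (y - x)) -> forall x, continuous g x.
Proof.
intros hL x. apply filterlim_locally. intros eps.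
assert (hL0 : 0 <= L).
{ pose proof (hL 0 1 ltac:(lra)). pose proof (Rabs_pos (g 1 - g 0)). lra. }
assert (hd : 0 < eps / (L + 1)) by (apply Rdiv_lt_0_compat; [apply cond_pos|lra]).
exists (mkposreal _ hd). intros y hy.
change (Rabs (y - x) < eps / (L + 1)) in hy. change (Rabs (g y - g x) < eps).
assert (H : Rabs (g y - g x) <= L * Rabs (y - x)).
{ destruct (Rle_or_lt x y).
  - rewrite (Rabs_pos_eq (y - x)) by lra. auto.
  - rewrite Rabs_minus_sym, (Rabs_minus_sym y), (Rabs_pos_eq (x - y)) by lra. apply hL; lra. }
apply Rle_lt_trans with (1 := H).
assert (0 <= Rabs (y - x)) by apply Rabs_pos.
assert (Rabs (y - x) * (L + 1) < eps / (L + 1) * (L + 1)) by (apply Rmult_lt_compat_r; lra).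
replace (eps / (L + 1) * (L + 1)) with (pos eps) in * by (field; lra). nra.
Qed.

(* Both cases of the recursion have this form, with d = 1, e = 2 for n even and d = 2, e = 1 for n odd. *)
Lemma tame_step (d e : R) (f g : R -> R) :
  1 <= d -> 1 <= e <= d + 1 -> d + 1 <= 3 -> d + 1 <= e \/ 3 <= d + 1 -> tame d f ->
  (forall s, e <= s -> g s = tail_integral f (Rmax (d + 1) s) / s) ->
  tame e g.
Proof.
intros hd he hd3 hcase hf hg.
(* The [Rmax] makes [G] constant to the left of d + 1. For n odd this is the plateau on [1,3]; for n
   even d + 1 = e and it changes nothing on the domain. *)
set (G := fun s => tail_integral f (Rmax (d + 1) s)).
assert (hGs : forall s, d + 1 <= s -> G s = tail_integral f (s - 1 + 1)).
{ intros s hs. unfold G. rewrite Rmax_right by lra. f_equal. ring. }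
assert (hGc : forall s, s <= d + 1 -> G s = G (d + 1)).
{ intros s hs. unfold G. rewrite Rmax_left, Rmax_left by lra. reflexivity. }
assert (hgG : forall s, e <= s -> s * g s = G s).
{ intros s hs. rewrite hg by assumption. unfold G. field. lra. }
assert (hGr : forall x, exists u, d + 1 <= u /\ x <= u /\ u = Rmax (d + 1) x /\ G x = G u).
{ intros x. exists (Rmax (d + 1) x). pose proof (Rmax_l (d + 1) x). pose proof (Rmax_r (d + 1) x).
  repeat split; try assumption. unfold G. rewrite (Rmax_right (d + 1) (Rmax (d + 1) x)) by lra. reflexivity. }
(* To the right of d + 1 the slope of [G] at s is -f(s - 1), which lies between -f(d) and 0. This
   one estimate gives both monotonicity and continuity. *)
assert (hGle : forall x y, x <= y -> 0 <= G x - G y <= f d * (y - x)).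
{ intros x y hxy. destruct (hGr x) as [u [h1 [h2 [hu ->]]]]. destruct (hGr y) as [v [h3 [h4 [hv ->]]]].
  assert (u <= v <= u + (y - x)).
  { subst u v. unfold Rmax in *. destruct (Rle_dec _ _), (Rle_dec _ _); lra. }
  rewrite (hGs u), (hGs v) by lra.
  pose proof (tail_integral_decr d f (u - 1) (v - 1) ltac:(lra) hf ltac:(lra)).
  pose proof (tail_integral_bounds d f (u - 1) (v - 1) ltac:(lra) hf ltac:(lra)) as [_ H1].
  assert (f (u - 1) <= f d) by (apply (tame_antitone d); lra || assumption).
  assert (0 <= f d) by (apply (tame_pos d); lra || assumption).
  split; [lra|]. nra. }
split.
(* Replacing s by [Rmax 1 s] gives a quotient that is continuous on the whole line and agrees with g
   on the domain. *)
- intros x y hxy. apply (ex_RInt_ext (fun s => G s * / Rmax 1 s)).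
  { intros s. rewrite Rmin_left by lra. intros hs.
    rewrite (Rmax_right 1 s) by lra. rewrite hg by lra. reflexivity. }
  apply (ex_RInt_continuous (V := R_CompleteNormedModule)). intros z _.
  apply (continuous_mult G (fun s => / Rmax 1 s)).
  + apply (lipschitz_continuous G (f d)). intros u v huv.
    rewrite Rabs_minus_sym, Rabs_pos_eq; apply hGle; exact huv.
  + apply (continuous_Rinv_comp (fun s => Rmax 1 s)).
    * apply (lipschitz_continuous _ 1). intros u v huv.
      unfold Rmax. destruct (Rle_dec _ _), (Rle_dec _ _); apply Rabs_le; lra.
    * pose proof (Rmax_l 1 z). lra.
- intros s hs. rewrite hgG by assumption. destruct (hGr s) as [u [h1 [h2 [_ ->]]]].
  rewrite hGs by assumption. apply (tail_integral_ge0 d); lra || assumption.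
- intros x y hxy. rewrite !hgG by lra. pose proof (hGle x y ltac:(lra)). lra.
- intros x t y hxt hty hc. rewrite !hgG by lra.
  (* To the right of d + 1, the value f(t - 1) separates the average slopes on the two sides of t,
     since f decreases. Otherwise d + 1 = 3 and y <= 3, so all three points lie on the plateau. *)
  destruct (Rle_or_lt (d + 1) x) as [hx|hx].
  + rewrite (hGs x), (hGs t), (hGs y) by lra.
    pose proof (tail_integral_bounds d f (x - 1) (t - 1) ltac:(lra) hf ltac:(lra)) as [H1 _].
    pose proof (tail_integral_bounds d f (t - 1) (y - 1) ltac:(lra) hf ltac:(lra)) as [_ H2].
    set (Gx := tail_integral f (x - 1 + 1)) in *. set (Gt := tail_integral f (t - 1 + 1)) in *.
    set (Gy := tail_integral f (y - 1 + 1)) in *. nra.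
  + rewrite (hGc x), (hGc t), (hGc y) by lra. right. ring.
- destruct (tail_integral_supp d f hf) as [b [hdb hb]]. exists (b + 1). intros s hs.
  rewrite hg, Rmax_right by lra. replace s with (s - 1 + 1) at 1 by ring.
  rewrite hb by lra. unfold Rdiv. ring.
Qed.

Lemma tame_f_one : tame 1 f_one.
Proof.
assert (E : forall s, 1 <= s -> s * f_one s = Rmax 0 (3 - s)).
{ intros s hs. unfold f_one, Rmax.
  destruct (Rlt_dec s 1), (Rle_dec s 3), (Rle_dec 0 (3 - s)); try lra; field; lra. }
split.
- intros x y hxy. apply (ex_RInt_ext (fun s => Rmax 0 (3 - s) * / Rmax 1 s)).
  { intros s. rewrite Rmin_left by lra. intros hs.
    rewrite <- (E s) by lra. rewrite (Rmax_right 1 s) by lra.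
    change (s * f_one s * / s = f_one s). field. lra. }
  apply (ex_RInt_continuous (V := R_CompleteNormedModule)). intros z _.
  apply (continuous_mult (fun s => Rmax 0 (3 - s)) (fun s => / Rmax 1 s)).
  + apply (lipschitz_continuous _ 1). intros u v huv.
    unfold Rmax. destruct (Rle_dec _ _), (Rle_dec _ _); apply Rabs_le; lra.
  + apply (continuous_Rinv_comp (fun s => Rmax 1 s)).
    * apply (lipschitz_continuous _ 1). intros u v huv.
      unfold Rmax. destruct (Rle_dec _ _), (Rle_dec _ _); apply Rabs_le; lra.
    * pose proof (Rmax_l 1 z). lra.
- intros s hs. rewrite E by assumption. apply Rmax_l.
- intros x y hxy. rewrite !E by lra. unfold Rmax. destruct (Rle_dec _ _), (Rle_dec _ _); lra.
- intros x t y hxt hty hc. rewrite !E by lra. unfold Rmax.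
  destruct (Rle_dec _ _), (Rle_dec _ _), (Rle_dec _ _); try nra.
- exists 4. intros s hs. unfold f_one. destruct (Rlt_dec s 1), (Rle_dec s 3); lra.
Qed.

(** * The recursion in integer arithmetic on the grid *)

(* 32 times the trapezoid sums from each grid point up to s = 8, plus the tail U. *)
Fixpoint sums (U : Z) (l : list Z) : list Z :=
  match l with
  | x :: ((y :: _) as l') => let r := sums U l' in (x + y + hd 0 r)%Z :: r
  | _ => U :: nil
  end.

(* The factor 2 / (3 k) is (4/3) (1/32) / (k/16): rescaling, the factor of [sums], and
   the division by s. *)
Fixpoint divs (k : Z) (l : list Z) : list Z :=
  match l with
  | nil => nil
  | a :: l' => (2 * a / (3 * k) + 1)%Z :: divs (k + 1) l'
  end.

Definition start (odd : bool) : Z := if odd then 16 else 32.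

(* U controls the tail: s f(s) <= (U/4) e^(8-s) for s >= 8, in scaled units; the
   integral of f over [8,oo) is then at most U/32.  [odd] is the parity of the new index. *)
Definition step (odd : bool) (st : Z * list Z) : Z * list Z :=
  let (U, l) := st in
  let r := firstn (length l - 16) (sums U l) in
  (Z.max U (last r 0) / 2 + 1,
   divs (start odd) (repeat (hd 0 r) (if odd then 32 else 0) ++ r))%Z.

Definition below (sigma : R) (f : R -> R) (k : Z) (l : list Z) : Prop :=
  forall i, (i < length l)%nat ->
    sigma * f (IZR (k + Z.of_nat i) / 16) <= IZR (nth i l 0%Z).

Lemma below_cons (sigma : R) (f : R -> R) (k x : Z) (l : list Z) :
  below sigma f k (x :: l) <->
  sigma * f (IZR k / 16) <= IZR x /\ below sigma f (k + 1) l.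
Proof.
split.
- intros H. split.
  + specialize (H 0%nat). cbn in H. rewrite Z.add_0_r in H. apply H. lia.
  + intros i hi. specialize (H (S i)). cbn [length nth] in H.
    replace (k + 1 + Z.of_nat i)%Z with (k + Z.of_nat (S i))%Z by lia. apply H. lia.
- intros [H0 H] [|i] hi.
  + cbn. rewrite Z.add_0_r. exact H0.
  + cbn [length nth] in *. replace (k + Z.of_nat (S i))%Z with (k + 1 + Z.of_nat i)%Z by lia.
    apply H. lia.
Qed.

Lemma length_sums (U : Z) (l : list Z) : l <> nil -> length (sums U l) = length l.
Proof.
induction l as [|x [|y l'] IH]; intros hl; [congruence|reflexivity|].
change (sums U (x :: y :: l')) with ((x + y + hd 0 (sums U (y :: l')))%Z :: sums U (y :: l')).
cbn [length]. rewrite IH; [reflexivity|congruence].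
Qed.

Lemma length_divs (l : list Z) : forall k, length (divs k l) = length l.
Proof. induction l as [|a l IH]; intros k; cbn; [reflexivity|]. rewrite IH. reflexivity. Qed.

(** The trapezoids are added from right to left, starting from the tail beyond 8. A trapezoid of
    width 1/16 is 1/32 times the sum of its two ends, hence the factor 32. The length condition
    places the last entry at index 128, where s = 8. *)
Lemma below_sums (d sigma : R) (f : R -> R) (U : Z) (l : list Z) :
  0 < d -> 0 <= sigma -> tame d f -> 32 * sigma * tail_integral f (8 + 1) <= IZR U ->
  forall k, 16 * d <= IZR k -> (k + Z.of_nat (length l) = 129)%Z -> l <> nil ->
  below sigma f k l ->
  below (32 * sigma) (fun s => tail_integral f (s + 1)) k (sums U l).
Proof.
intros hd0 hsigma hf hU.
induction l as [|x [|y l'] IH]; intros k hk hlen hl H; [congruence| |].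
- apply below_cons. split; [|intros i hi; cbn in hi; lia].
  cbn [length] in hlen. replace k with 128%Z by lia. replace (128 / 16) with 8 by field. exact hU.
- change (sums U (x :: y :: l')) with ((x + y + hd 0 (sums U (y :: l')))%Z :: sums U (y :: l')).
  apply below_cons in H. destruct H as [Hx H].
  assert (IH' : below (32 * sigma) (fun s => tail_integral f (s + 1)) (k + 1) (sums U (y :: l'))).
  { apply IH; [rewrite plus_IZR; lra|cbn [length] in *; lia|congruence|exact H]. }
  apply below_cons. split; [|exact IH'].
  apply below_cons in H. destruct H as [Hy _].
  pose proof (length_sums U (y :: l') ltac:(congruence)) as hls.
  destruct (sums U (y :: l')) as [|a r]; [discriminate|]. cbn [hd].
  apply below_cons in IH'. destruct IH' as [Ha _].
  rewrite plus_IZR in Hy, Ha. rewrite !plus_IZR.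
  assert (T : tail_integral f (IZR k / 16 + 1) - tail_integral f ((IZR k + 1) / 16 + 1)
     <= ((IZR k + 1) / 16 - IZR k / 16) / 2 * (f (IZR k / 16) + f ((IZR k + 1) / 16))).
  { apply (tail_integral_trapezoid d); [exact hd0|exact hf|lra|].
    (* Index 48 is s = 3, so no grid cell straddles it. *)
    destruct (Z_le_gt_dec k 47) as [h|h].
    - left. apply IZR_le in h. lra.
    - right. assert (h' : (48 <= k)%Z) by lia. apply IZR_le in h'. lra. }
  apply Rmult_le_compat_l with (r := 32 * sigma) in T; [|lra].
  lra.
Qed.

Lemma div_up (a b : Z) : (0 < b)%Z -> IZR a / IZR b <= IZR (a / b + 1).
Proof.
intros hb. assert (hb' : 0 < IZR b) by (apply IZR_lt; exact hb).
apply Rmult_le_reg_l with (IZR b); [exact hb'|].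
replace (IZR b * (IZR a / IZR b)) with (IZR a) by (field; lra).
rewrite <- mult_IZR. apply IZR_le.
pose proof (Z_div_mod_eq_full a b). pose proof (Z.mod_pos_bound a b hb). lia.
Qed.

Lemma div_down (a b : Z) : (0 < b)%Z -> IZR (a / b) <= IZR a / IZR b.
Proof.
intros hb. assert (hb' : 0 < IZR b) by (apply IZR_lt; exact hb).
apply Rmult_le_reg_l with (IZR b); [exact hb'|].
replace (IZR b * (IZR a / IZR b)) with (IZR a) by (field; lra).
rewrite <- mult_IZR. apply IZR_le. apply Z.mul_div_le. exact hb.
Qed.

Lemma below_divs (sigma : R) (g G : R -> R) (l : list Z) :
  forall k, (0 < k)%Z -> (forall s, IZR k / 16 <= s -> g s = G s / s) ->
  below (32 * sigma) G k l -> below (4 / 3 * sigma) g k (divs k l).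
Proof.
induction l as [|a l IH]; intros k hk hg H; [intros i hi; cbn in hi; lia|].
apply below_cons in H. destruct H as [H0 H]. cbn [divs]. apply below_cons. split.
- apply Rle_trans with (2 := div_up (2 * a) (3 * k) ltac:(lia)).
  rewrite hg by lra. rewrite !mult_IZR.
  assert (hk' : 0 < IZR k) by (apply IZR_lt; exact hk).
  replace (4 / 3 * sigma * (G (IZR k / 16) / (IZR k / 16)))
    with (32 * sigma * G (IZR k / 16) * (2 / (3 * IZR k))) by (field; lra).
  replace (2 * IZR a / (3 * IZR k)) with (IZR a * (2 / (3 * IZR k))) by (field; lra).
  apply Rmult_le_compat_r; [|exact H0]. apply Rdiv_le_0_compat; lra.
- apply IH; [lia| |exact H]. intros s hs. apply hg. rewrite plus_IZR in hs. lra.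
Qed.

Lemma nth_firstn_lt (n i : nat) (l : list Z) : (i < n)%nat -> nth i (firstn n l) 0%Z = nth i l 0%Z.
Proof. intros h. rewrite nth_firstn. apply Nat.ltb_lt in h. rewrite h. reflexivity. Qed.

(** The loop invariant: f, scaled by sigma, is bounded by the state, on the grid up to index 128 and
    by the exponential beyond s = 8. *)
Record dominated (odd : bool) (sigma : R) (f : R -> R) (st : Z * list Z) : Prop := {
  dom_tame : tame (if odd then 1 else 2) f;
  dom_len : (start odd + Z.of_nat (length (snd st)) = 129)%Z;
  dom_below : below sigma f (start odd) (snd st);
  dom_tail : forall s, 8 <= s -> sigma * (s * f s) <= IZR (fst st) / 4 * exp (8 - s);
  dom_tail_ge0 : 0 <= IZR (fst st) }.

(** The sum starting at index k bounds s g(s) at index k + 16, so the last 16 sums would fall beyond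
    s = 8 and are dropped. For odd n the first remaining sum belongs to s = 3, and its 32 copies
    fill the plateau at indices 16 to 47. *)
Lemma dominated_step (odd : bool) (sigma : R) (f g : R -> R) (st : Z * list Z) :
  0 < sigma -> dominated (negb odd) sigma f st ->
  (forall s, (if odd then 1 else 2) <= s ->
     g s = tail_integral f (Rmax (if odd then 3 else 2) s) / s) ->
  dominated odd (4 / 3 * sigma) g (step odd st).
Proof.
intros hsigma [hf hlen hb htail hU] hg. destruct st as [U l]. cbn [fst snd] in *.
set (d := if negb odd then 1 else 2) in *.
assert (hd0 : 1 <= d <= 2) by (unfold d; destruct odd; cbn; lra).
assert (hstart : IZR (start (negb odd)) = 16 * d) by (unfold d; destruct odd; cbn; lra).
assert (hd1 : (if odd then 3 else 2) = d + 1) by (unfold d; destruct odd; cbn; lra).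
rewrite hd1 in hg.
assert (hll : (length l = if odd then 97 else 113)%nat) by (destruct odd; cbn [start negb] in hlen; lia).
assert (hl : l <> nil) by (intros ->; destruct odd; discriminate hll).
pose proof (length_sums U l hl) as hls.
assert (hU8 : 32 * sigma * tail_integral f (8 + 1) <= IZR U).
{ assert (H := tail_integral_exp d f (IZR U / 4 / sigma) 8 8 hf ltac:(lra) ltac:(lra)).
  replace (8 - 8) with 0 in H by ring. rewrite exp_0 in H.
  assert (H' : tail_integral f (8 + 1) <= IZR U / 4 / sigma / 8 * 1).
  { apply H; [apply Rdiv_le_0_compat; lra|]. intros s hs.
    apply Rmult_le_reg_l with sigma; [lra|].
    replace (sigma * (IZR U / 4 / sigma * exp (8 - s))) with (IZR U / 4 * exp (8 - s)) by (field; lra).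
    auto. }
  apply Rmult_le_compat_l with (r := 32 * sigma) in H'; [|lra].
  replace (IZR U) with (32 * sigma * (IZR U / 4 / sigma / 8 * 1)) by (field; lra). exact H'. }
assert (hs := below_sums d sigma f U l ltac:(lra) ltac:(lra) hf hU8 _
  ltac:(rewrite hstart; lra) hlen hl hb).
unfold step. set (r := firstn (length l - 16) (sums U l)).
assert (hr : length r = (length l - 16)%nat) by (unfold r; rewrite length_firstn; lia).
assert (hbr : below (32 * sigma) (fun s => tail_integral f (s + 1)) (start (negb odd)) r).
{ intros i hi. unfold r. rewrite nth_firstn_lt by lia. apply hs. lia. }
assert (hr0 : (0 < length r)%nat) by (rewrite hr, hll; destruct odd; lia).
(* The last sum kept has index 112, so it integrates f from 7 on. *)
assert (hlast : 32 * sigma * tail_integral f 8 <= IZR (last r 0%Z)).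
{ assert (E : last r 0%Z = nth (length r - 1) r 0%Z).
  { destruct (exists_last (l := r)) as [r' [a ->]]; [intros E; rewrite E in hr0; cbn in hr0; lia|].
    rewrite last_last, length_app, app_nth2; cbn; [|lia].
    replace (length r' + 1 - 1 - length r')%nat with 0%nat by lia. reflexivity. }
  rewrite E. specialize (hbr (length r - 1)%nat ltac:(lia)). cbv beta in hbr.
  replace (start (negb odd) + Z.of_nat (length r - 1))%Z with 112%Z in hbr by lia.
  replace (112 / 16 + 1) with 8 in hbr by field. exact hbr. }
assert (hhd : 32 * sigma * tail_integral f (d + 1) <= IZR (hd 0%Z r)).
{ specialize (hbr 0%nat hr0). cbv beta in hbr. rewrite Z.add_0_r, hstart in hbr.
  replace (16 * d / 16) with d in hbr by field.
  destruct r as [|a r']; [cbn in hr0; lia|]. exact hbr. }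
assert (hV : Rmax (IZR U) (IZR (last r 0%Z)) / 2 <= IZR (Z.max U (last r 0%Z) / 2 + 1)).
{ apply Rle_trans with (2 := div_up _ 2 ltac:(lia)).
  apply Rmult_le_compat_r; [lra|].
  apply Rmax_lub; apply IZR_le; lia. }
pose proof (Rmax_l (IZR U) (IZR (last r 0%Z))) as hm1.
pose proof (Rmax_r (IZR U) (IZR (last r 0%Z))) as hm2.
assert (hm : start odd = (start (negb odd) + 16 - Z.of_nat (if odd then 32 else 0))%Z)
  by (destruct odd; reflexivity).
split; cbn [fst snd].
- apply (tame_step d _ f g); [lra|destruct odd; unfold d; cbn; lra|lra
    |destruct odd; unfold d; cbn; lra|exact hf|exact hg].
- rewrite length_divs, length_app, repeat_length, hr. destruct odd; cbn [start negb] in *; lia.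
- apply (below_divs sigma g (fun s => tail_integral f (Rmax (d + 1) s))).
  + destruct odd; cbn; lia.
  + intros s hs'. apply hg. destruct odd; cbn in hs'; lra.
  + intros i hi. rewrite length_app, repeat_length in hi.
    destruct (Nat.lt_ge_cases i (if odd then 32 else 0)) as [him|him].
    * rewrite app_nth1 by (rewrite repeat_length; exact him).
      rewrite nth_repeat_lt by exact him.
      rewrite Rmax_left; [exact hhd|].
      assert (IZR (start odd + Z.of_nat i) <= IZR (start (negb odd) + 16)) by (apply IZR_le; lia).
      rewrite (plus_IZR _ 16), hstart in H. lra.
    * rewrite app_nth2, repeat_length by (rewrite repeat_length; exact him).
      specialize (hbr (i - if odd then 32 else 0)%nat ltac:(lia)). cbv beta in hbr.
      replace (IZR (start odd + Z.of_nat i) / 16)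
        with (IZR (start (negb odd) + Z.of_nat (i - if odd then 32 else 0)) / 16 + 1).
      2: { replace (start odd + Z.of_nat i)%Z with
        (start (negb odd) + Z.of_nat (i - if odd then 32 else 0) + 16)%Z by lia.
        rewrite (plus_IZR _ 16). field. }
      rewrite Rmax_right; [exact hbr|].
      assert (IZR (start (negb odd)) <= IZR (start (negb odd) + Z.of_nat (i - if odd then 32 else 0)))
        by (apply IZR_le; lia). lra.
- intros s hs'.
  assert (hs1 : (if odd then 1 else 2) <= s) by (destruct odd; lra).
  assert (hE : 4 / 3 * sigma * (s * g s) = 4 / 3 * sigma * tail_integral f s).
  { rewrite hg by exact hs1. rewrite Rmax_right by lra. field. lra. }
  rewrite hE. pose proof exp_le_3 as he. pose proof (exp_pos 1) as he0.
  (* For s >= 9 the old exponential bound is integrated from s - 1 >= 8 and gives U e/24 <= U/8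
     times the exponential. For s < 9 monotonicity gives last/24, and exp (8 - s) >= 1/3 turns this
     into last/8. Both use only e <= 3, and both explain halving the maximum. *)
  destruct (Rle_or_lt 9 s) as [h9|h9].
  + assert (H := tail_integral_exp d f (IZR U / 4 / sigma) 8 (s - 1) hf ltac:(lra) ltac:(lra)).
    replace (s - 1 + 1) with s in H by ring.
    replace (8 - (s - 1)) with (1 + (8 - s)) in H by ring. rewrite exp_plus in H.
    pose proof (exp_pos (8 - s)) as hes.
    apply Rle_trans with (4 / 3 * sigma * (IZR U / 4 / sigma / 8 * (exp 1 * exp (8 - s)))).
    * apply Rmult_le_compat_l; [lra|]. apply H; [apply Rdiv_le_0_compat; lra|]. intros t ht.
      apply Rmult_le_reg_l with sigma; [lra|].
      replace (sigma * (IZR U / 4 / sigma * exp (8 - t))) with (IZR U / 4 * exp (8 - t)) by (field; lra).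
      auto.
    * replace (4 / 3 * sigma * (IZR U / 4 / sigma / 8 * (exp 1 * exp (8 - s))))
        with (IZR U * exp 1 / 24 * exp (8 - s)) by (field; lra).
      apply Rmult_le_compat_r; [lra|]. nra.
  + assert (H := tail_integral_decr d f 7 (s - 1) ltac:(lra) hf ltac:(lra)).
    replace (s - 1 + 1) with s in H by ring. replace (7 + 1) with 8 in H by ring.
    assert (hes : exp 1 * exp (8 - s) >= 1).
    { rewrite <- exp_plus. pose proof (exp_ineq1_le (1 + (8 - s))). lra. }
    pose proof (exp_pos (8 - s)) as hes0.
    assert (1 / 3 <= exp (8 - s)) by nra.
    apply Rle_trans with (4 / 3 * sigma * tail_integral f 8); [apply Rmult_le_compat_l; lra|].
    apply Rle_trans with (IZR (last r 0%Z) / 24); [lra|].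
    assert (0 <= tail_integral f 8).
    { replace 8 with (7 + 1) by ring. apply (tail_integral_ge0 d); lra || assumption. }
    assert (0 <= IZR (last r 0%Z)) by nra. nra.
- lra.
Qed.

(** * Comparison of the grid bounds with the envelope *)

(** Up to index 48 the target is a multiple of exp (-s) and f itself is tested. Beyond it the target
    has the factor 3/s, so s f(s)/3 is tested, that is k x/48. The final test is U/4 <= 3 e, for the
    tail. *)
Fixpoint fits (U k e : Z) (l : list Z) : bool :=
  (match l with
   | nil => U <=? 12 * e
   | x :: l' =>
       (if k <=? 48 then x <=? e else k * x <=? 48 * e) &&
       fits U (k + 1) (e * 15 / 16) l'
   end)%Z.

Definition cent (n : nat) : Z :=
  (if (n <=? 2)%nat then 33 else if (n <=? 3)%nat then 39 else if (n <=? 4)%nat then 45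
   else if (n <=? 5)%nat then 51 else if (n <=? 6)%nat then 54 else if (n <=? 7)%nat then 57
   else if (n <=? 8)%nat then 58 else if (n <=? 10)%nat then 61 else if (n <=? 12)%nat then 63
   else if (n <=? 13)%nat then 64 else if (n <=? 14)%nat then 65 else if (n <=? 18)%nat then 66
   else if (n <=? 20)%nat then 67 else if (n <=? 24)%nat then 68 else if (n <=? 32)%nat then 69
   else if (n <=? 46)%nat then 70 else if (n <=? 80)%nat then 71 else if (n <=? 308)%nat then 72
   else 73)%Z.

(* Rounding down after each factor keeps the numbers of bounded size. *)
Fixpoint power_down (a c : Z) (m : nat) : Z :=
  match m with
  | O => a
  | S m' => (power_down a c m' * c / 75)%Z
  end.

(** The starting envelope value e_32: 2 c_n^(n-1) times the scale 2^40 (4/3)^(n-1), rounded down.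
    The 75 in [power_down] comes from (4/3)(c/100) = c/75. *)
Definition kappa (n : nat) : Z := power_down (2 ^ 41) (cent n) (n - 1).

(** On [1,2] h is constant and f decreases, so for odd n the head of the list settles that interval.
    Skipping 16 entries then moves the list to s = 2. *)
Definition check (n : nat) (st : Z * list Z) : bool :=
  let (U, l) := st in
  (hd 0 l <=? kappa n)%Z && fits U 32 (kappa n) (skipn (if Nat.odd n then 16 else 0) l).

Fixpoint run (m n : nat) (st : Z * list Z) : bool :=
  match m with
  | O => true
  | S m' =>
      let st' := step (Nat.odd (S n)) st in
      check (S n) st' && run m' (S n) st'
  end.

(** At index i, f_1 is (48 - i)/i, cut off at 0 past s = 3. Its tail beyond 8 vanishes, hence U =
    0. *)
Definition init : Z * list Z :=
  (0%Z, map (fun i => Z.max 0 (2 ^ 40 * (48 - Z.of_nat i) / Z.of_nat i + 1)) (seq 16 113)).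

Lemma run_init : run 449 1 init = true.
(* The kernel evaluates all 449 steps, once, at [Qed]. *)
Proof. vm_cast_no_check (eq_refl true). Qed.

Lemma cn_cent (n : nat) : cn n = IZR (cent n) / 100.
Proof.
unfold cn, cent.
repeat match goal with |- context [(n <=? ?m)%nat] => destruct (n <=? m)%nat; [lra|] end.
lra.
Qed.

Lemma cent_ge0 (n : nat) : (0 <= cent n)%Z.
Proof.
unfold cent.
repeat match goal with |- context [(n <=? ?m)%nat] => destruct (n <=? m)%nat; [lia|] end.
lia.
Qed.

Definition scale (n : nat) : R := 2 ^ 40 * (4 / 3) ^ (n - 1).

Lemma power_down_bounds (a c : Z) (m : nat) :
  (0 <= a)%Z -> (0 <= c)%Z -> 0 <= IZR (power_down a c m) <= IZR a * (IZR c / 75) ^ m.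
Proof.
intros ha hc. induction m as [|m [IH0 IH]]; cbn [power_down pow].
- apply IZR_le in ha. lra.
- apply (le_IZR 0) in IH0. apply IZR_le in hc as hc'. split.
  + apply IZR_le. apply Z.div_pos; lia.
  + apply Rle_trans with (1 := div_down _ 75 ltac:(lia)). rewrite mult_IZR. nra.
Qed.

Lemma kappa_bounds (n : nat) : 0 <= IZR (kappa n) <= 2 * scale n * cn n ^ (n - 1).
Proof.
unfold kappa.
destruct (power_down_bounds (2 ^ 41) (cent n) (n - 1) ltac:(lia) (cent_ge0 n)) as [H0 H].
split; [exact H0|]. apply Rle_trans with (1 := H).
unfold scale. rewrite cn_cent.
replace (2 * (2 ^ 40 * (4 / 3) ^ (n - 1)) * (IZR (cent n) / 100) ^ (n - 1))
  with (2 ^ 41 * ((4 / 3) ^ (n - 1) * (IZR (cent n) / 100) ^ (n - 1))) by ring.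
rewrite <- Rpow_mult_distr.
replace (4 / 3 * (IZR (cent n) / 100)) with (IZR (cent n) / 75) by field.
right. f_equal. rewrite (pow_IZR 2 41). reflexivity.
Qed.

Lemma exp2_h (s : R) : 2 <= s ->
  exp 2 * h s = if Rle_dec s 3 then exp (2 - s) else 3 / s * exp (2 - s).
Proof.
intros hs. unfold h, Rminus. rewrite exp_plus.
destruct (Rle_dec s 2).
- replace s with 2 by lra. destruct (Rle_dec 2 3); [reflexivity|lra].
- destruct (Rle_dec s 3); [reflexivity|field; lra].
Qed.

(** With x = s - k/16, the chord from e to at most 15 e/16 over a width of 1/16 lies below e (1 -
    x), and 1 - x <= exp (-x). *)
Lemma chord_le_exp (k : Z) (s e e' ka u v w : R) :
  IZR k / 16 <= s <= (IZR k + 1) / 16 ->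
  e <= ka * exp (2 - IZR k / 16) -> 0 <= ka ->
  u <= e -> v <= e' -> e' <= e * 15 / 16 ->
  / 16 * w <= ((IZR k + 1) / 16 - s) * u + (s - IZR k / 16) * v ->
  w <= ka * exp (2 - s).
Proof.
intros hs he hka hu hv he' hw.
replace (2 - s) with ((2 - IZR k / 16) + (IZR k / 16 - s)) by ring.
rewrite exp_plus. pose proof (exp_ineq1_le (IZR k / 16 - s)) as H1.
pose proof (exp_pos (2 - IZR k / 16)) as H2.
set (x := s - IZR k / 16) in *.
replace (IZR k / 16 - s) with (- x) in * by (unfold x; ring).
assert (hx : 0 <= x <= / 16) by (unfold x; lra).
replace ((IZR k + 1) / 16 - s) with (/ 16 - x) in hw by (unfold x; field).
assert (w <= e * (1 - x)) by nra.
apply Rle_trans with (ka * exp (2 - IZR k / 16) * (1 - x)); [nra|].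
rewrite <- Rmult_assoc. apply Rmult_le_compat_l; [nra|lra].
Qed.

(** The induction treats one grid cell at a time and passes larger s on. The alternative 8 <= s is
    needed because the list runs out at k = 129, slightly past s = 8. *)
Lemma fits_spec (d sigma ka : R) (f : R -> R) (U : Z) (l : list Z) :
  0 < d <= 2 -> 0 < sigma -> 0 <= ka -> tame d f ->
  (forall s, 8 <= s -> sigma * (s * f s) <= IZR U / 4 * exp (8 - s)) ->
  forall k e, (32 <= k)%Z -> (k + Z.of_nat (length l) = 129)%Z ->
  below sigma f k l -> fits U k e l = true -> IZR e <= ka * exp (2 - IZR k / 16) ->
  forall s, IZR k / 16 <= s \/ 8 <= s -> sigma * f s <= ka * (exp 2 * h s).
Proof.
intros hd0 hsigma hka hf htail.
assert (decay : forall k e, (32 <= k)%Z -> IZR e <= ka * exp (2 - IZR k / 16) ->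
  IZR (e * 15 / 16) <= ka * exp (2 - IZR (k + 1) / 16)).
{ intros k e hk he. apply Rle_trans with (1 := div_down _ 16 ltac:(lia)).
  rewrite mult_IZR, plus_IZR.
  replace (2 - (IZR k + 1) / 16) with ((2 - IZR k / 16) + - (1 / 16)) by field.
  rewrite exp_plus. pose proof (exp_ineq1_le (- (1 / 16))).
  pose proof (exp_pos (2 - IZR k / 16)).
  apply Rle_trans with (ka * exp (2 - IZR k / 16) * (15 / 16)); [lra|].
  rewrite <- Rmult_assoc. apply Rmult_le_compat_l; [|lra]. apply Rmult_le_pos; lra. }
induction l as [|x l IH]; intros k e hk hlen hb hfit he s hs.
- cbn [fits] in hfit. apply Z.leb_le, IZR_le in hfit. rewrite mult_IZR in hfit.
  cbn [length] in hlen. replace k with 129%Z in * by lia.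
  assert (h8 : 8 <= s) by lra.
  rewrite exp2_h by lra. destruct (Rle_dec s 3); [lra|].
  apply Rmult_le_reg_l with s; [lra|].
  replace (s * (ka * (3 / s * exp (2 - s)))) with (3 * (ka * exp (2 - 8)) * exp (8 - s)).
  2: { replace (2 - s) with ((2 - 8) + (8 - s)) by ring. rewrite exp_plus. field. lra. }
  replace (s * (sigma * f s)) with (sigma * (s * f s)) by ring.
  apply Rle_trans with (1 := htail s h8).
  apply Rmult_le_compat_r; [left; apply exp_pos|].
  assert (ka * exp (2 - 129 / 16) <= ka * exp (2 - 8)); [|lra].
  apply Rmult_le_compat_l; [exact hka|]. left. apply exp_increasing. lra.
- cbn [fits] in hfit. apply andb_prop in hfit. destruct hfit as [hx hfit].
  pose proof hb as hb'. apply below_cons in hb. destruct hb as [hfx hb].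
  pose proof (decay k e hk he) as he'.
  cbn [length] in hlen.
  assert (next : IZR (k + 1) / 16 <= s \/ 8 <= s -> sigma * f s <= ka * (exp 2 * h s)).
  { apply (IH (k + 1)%Z (e * 15 / 16)%Z); [lia|lia|exact hb|exact hfit|exact he']. }
  destruct (Rle_or_lt (IZR (k + 1) / 16) s) as [h1|h1]; [auto|].
  destruct (Rle_or_lt 8 s) as [h8|h8]; [auto|].
  destruct hs as [hs|hs]; [|lra].
  destruct l as [|y l].
  { cbn [length] in hlen. replace k with 128%Z in hs by lia. lra. }
  cbn [fits] in hfit. apply andb_prop in hfit. destruct hfit as [hy _].
  apply below_cons in hb. destruct hb as [hfy _].
  pose proof (div_down (e * 15) 16 ltac:(lia)) as hdd. rewrite mult_IZR in hdd.
  set (e' := (e * 15 / 16)%Z) in *. clearbody e'.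
  rewrite plus_IZR in hfy, h1.
  assert (hk2 : 32 <= IZR k) by (apply IZR_le; exact hk).
  destruct (Z_le_gt_dec k 47) as [hk47|hk47].
  + assert (hk3 : IZR k <= 47) by (apply IZR_le; exact hk47).
    rewrite (proj2 (Z.leb_le k 48)) in hx by lia. rewrite (proj2 (Z.leb_le (k + 1) 48)) in hy by lia.
    apply Z.leb_le, IZR_le in hx. apply Z.leb_le, IZR_le in hy.
    rewrite exp2_h by lra. destruct (Rle_dec s 3); [|lra].
    apply (chord_le_exp k s (IZR e) (IZR e') ka (sigma * f (IZR k / 16)) (sigma * f ((IZR k + 1) / 16)));
      try lra.
    pose proof (tame_chord_fun d f (IZR k / 16) s ((IZR k + 1) / 16) ltac:(lra) hf
      ltac:(lra) ltac:(lra) ltac:(lra)) as H. nra.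
  + assert (hk3 : 48 <= IZR k) by (apply IZR_le; lia).
    assert (hx' : IZR k * IZR x <= 48 * IZR e).
    (* At k = 48 the two forms of the test coincide. *)
    { destruct (k <=? 48)%Z eqn:E.
      - apply Z.leb_le in E. replace k with 48%Z by lia. apply Z.leb_le, IZR_le in hx. lra.
      - apply Z.leb_le, IZR_le in hx. rewrite !mult_IZR in hx. exact hx. }
    rewrite (proj2 (Z.leb_gt (k + 1) 48)) in hy by lia.
    apply Z.leb_le, IZR_le in hy. rewrite !mult_IZR, plus_IZR in hy.
    assert (H : sigma * (s * f s) / 3 <= ka * exp (2 - s)).
    { apply (chord_le_exp k s (IZR e) (IZR e') ka
        (sigma * (IZR k / 16 * f (IZR k / 16)) / 3)
        (sigma * ((IZR k + 1) / 16 * f ((IZR k + 1) / 16)) / 3)); try lra; try nra.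
      pose proof (tame_chord d f hf (IZR k / 16) s ((IZR k + 1) / 16)
        ltac:(lra) ltac:(lra) ltac:(lra)) as H. nra. }
    rewrite exp2_h by lra.
    assert (hgoal : sigma * f s <= ka * (3 / s * exp (2 - s))).
    { apply Rmult_le_reg_l with (s / 3); [lra|].
      replace (s / 3 * (ka * (3 / s * exp (2 - s)))) with (ka * exp (2 - s)) by (field; lra). lra. }
    destruct (Rle_dec s 3); [|exact hgoal].
    replace (3 / s) with 1 in hgoal; [lra|]. replace s with 3 by lra. field.
Qed.

Lemma check_spec (n : nat) (f : R -> R) (st : Z * list Z) (s : R) :
  dominated (Nat.odd n) (scale n) f st -> check n st = true ->
  (if Nat.odd n then 1 else 2) <= s ->
  f s <= 2 * exp 2 * cn n ^ (n - 1) * h s.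
Proof.
intros [hf hlen hb htail hU] hc hs. destruct st as [U l]. cbn [fst snd] in *.
unfold check in hc. apply andb_prop in hc. destruct hc as [hhd hfit].
apply Z.leb_le, IZR_le in hhd.
assert (hscale : 0 < scale n) by (unfold scale; apply Rmult_lt_0_compat; apply pow_lt; lra).
destruct (kappa_bounds n) as [hka hkappa].
assert (key : scale n * f s <= IZR (kappa n) * (exp 2 * h s)).
{ set (d := if Nat.odd n then 1 else 2) in *.
  set (m := if Nat.odd n then 16%nat else 0%nat) in *.
  assert (hd0 : 0 < d <= 2) by (unfold d; destruct (Nat.odd n); lra).
  assert (hm : (start (Nat.odd n) + Z.of_nat m = 32)%Z) by (unfold m; destruct (Nat.odd n); reflexivity).
  destruct (Rle_or_lt 2 s) as [h2|h2].
  - apply (fits_spec d (scale n) (IZR (kappa n)) f U (skipn m l) hd0 hscale hka hf htail 32 (kappa n));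
      [lia| | |exact hfit| |left; lra].
    + rewrite length_skipn. lia.
    + intros i hi. rewrite length_skipn in hi. rewrite nth_skipn.
      specialize (hb (m + i)%nat ltac:(lia)).
      replace (32 + Z.of_nat i)%Z with (start (Nat.odd n) + Z.of_nat (m + i))%Z by lia. exact hb.
    + replace (2 - 32 / 16) with 0 by field. rewrite exp_0. lra.
  - unfold d in hs. destruct (Nat.odd n) eqn:Eodd; [|lra].
    unfold h. destruct (Rle_dec s 2); [|lra]. rewrite <- exp_plus.
    replace (2 + -2) with 0 by ring. rewrite exp_0, Rmult_1_r.
    apply Rle_trans with (2 := hhd).
    destruct l as [|x l]; [cbn in hlen; lia|]. apply below_cons in hb. destruct hb as [hb _].
    apply Rle_trans with (2 := hb). apply Rmult_le_compat_l; [lra|].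
    cbn [start]. replace (16 / 16) with 1 by field.
    apply (tame_antitone 1); [lra|exact hf|lra]. }
assert (hh : 0 < h s).
{ unfold h. destruct (Rle_dec s 2); [apply exp_pos|]. destruct (Rle_dec s 3); [apply exp_pos|].
  apply Rmult_lt_0_compat; [|apply exp_pos]. apply Rmult_lt_0_compat; [lra|].
  apply Rinv_0_lt_compat. lra. }
apply Rmult_le_reg_l with (scale n); [exact hscale|].
apply Rle_trans with (1 := key).
replace (scale n * (2 * exp 2 * cn n ^ (n - 1) * h s))
  with (2 * scale n * cn n ^ (n - 1) * (exp 2 * h s)) by ring.
apply Rmult_le_compat_r; [|exact hkappa]. apply Rmult_le_pos; [left; apply exp_pos|lra].
Qed.

(** * The start of the recursion and the induction on n *)

Lemma dominated_init : dominated true (scale 1) (fn 1) init.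
Proof.
split; cbn [fst snd init start].
- exact tame_f_one.
- rewrite length_map, length_seq. reflexivity.
- intros i hi. rewrite length_map, length_seq in hi.
  (* The default becomes the image of 0 under the mapped function, the form that [map_nth]
     expects. *)
  rewrite (nth_indep _ 0%Z (Z.max 0 (2 ^ 40 * (48 - Z.of_nat 0) / Z.of_nat 0 + 1)))
    by (rewrite length_map, length_seq; exact hi).
  rewrite (map_nth (fun i => Z.max 0 (2 ^ 40 * (48 - Z.of_nat i) / Z.of_nat i + 1))).
  rewrite seq_nth by exact hi.
  replace (16 + Z.of_nat i)%Z with (Z.of_nat (16 + i)) by lia.
  set (k := Z.of_nat (16 + i)). assert (hk : (16 <= k)%Z) by lia.
  assert (hk' : 16 <= IZR k) by (apply IZR_le; exact hk).
  unfold fn, f_one, scale. destruct (Rlt_dec _ 1); [lra|]. destruct (Rle_dec _ 3).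
  + apply Rle_trans with (IZR (2 ^ 40 * (48 - k) / k + 1)); [|apply IZR_le; lia].
    apply Rle_trans with (2 := div_up _ k ltac:(lia)).
    rewrite mult_IZR, minus_IZR. change (IZR (2 ^ 40)) with (IZR (2 ^ Z.of_nat 40)).
    rewrite <- pow_IZR. right. cbn [Nat.sub]. rewrite (pow_O (4 / 3)). field. lra.
  + rewrite Rmult_0_r. apply IZR_le. lia.
- intros s hs. unfold fn, f_one. destruct (Rlt_dec s 1); [lra|]. destruct (Rle_dec s 3); [lra|].
  rewrite !Rmult_0_r. unfold Rdiv. rewrite !Rmult_0_l. lra.
- lra.
Qed.

Lemma fn_step (n : nat) (s : R) :
  (1 <= n)%nat -> (if Nat.odd (S n) then 1 else 2) <= s ->
  fn (S n) s = tail_integral (fn n) (Rmax (if Nat.odd (S n) then 3 else 2) s) / s.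
Proof.
intros hn hs. destruct n as [|n]; [lia|].
rewrite <- Nat.negb_even in *.
change (fn (S (S n)) s) with
  ((if Nat.even (S (S n)) then f_even (fn (S n)) else f_odd (fn (S n))) s).
destruct (Nat.even (S (S n))); cbn [negb] in *.
- unfold f_even. destruct (Rlt_dec s 2); [lra|]. rewrite Rmax_right by lra. reflexivity.
- unfold f_odd. destruct (Rlt_dec s 1); [lra|]. destruct (Rle_dec s 3).
  + rewrite Rmax_left by lra. field. lra.
  + rewrite Rmax_right by lra. reflexivity.
Qed.

Lemma run_spec (m : nat) : forall (n : nat) (st : Z * list Z),
  (1 <= n)%nat -> dominated (Nat.odd n) (scale n) (fn n) st -> run m n st = true ->
  forall j s, (n < j <= n + m)%nat -> (if Nat.odd j then 1 else 2) <= s ->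
  fn j s <= 2 * exp 2 * cn j ^ (j - 1) * h s.
Proof.
induction m as [|m IH]; intros n st hn hst hrun j s hj hs; [lia|].
cbn [run] in hrun. apply andb_prop in hrun. destruct hrun as [hc hrun].
assert (hst' : dominated (Nat.odd (S n)) (scale (S n)) (fn (S n)) (step (Nat.odd (S n)) st)).
{ replace (scale (S n)) with (4 / 3 * scale n).
  2: { unfold scale. replace (S n - 1)%nat with (S (n - 1)) by lia. rewrite <- (tech_pow_Rmult (4 / 3)). ring. }
  apply (dominated_step _ _ (fn n)).
  - unfold scale. apply Rmult_lt_0_compat; apply pow_lt; lra.
  - rewrite Nat.odd_succ, Nat.negb_even. exact hst.
  - intros t ht. apply fn_step; assumption. }
destruct (Nat.eq_dec j (S n)) as [->|hne].
- apply (check_spec (S n) (fn (S n)) (step (Nat.odd (S n)) st)); assumption.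
- apply (IH (S n) (step (Nat.odd (S n)) st)); (lia || assumption).
Qed.

Theorem theorem7 (n : nat) (hn2 : (2 <= n)%nat) (hn450 : (n <= 450)%nat) :
  (Nat.Odd n -> forall s : R, 1 <= s ->
     fn n s <= 2 * exp 2 * cn n ^ (n - 1) * h s) /\
  (Nat.Even n -> forall s : R, 2 <= s ->
     fn n s <= 2 * exp 2 * cn n ^ (n - 1) * h s).
Proof.
split; intros hpar s hs;
  apply (run_spec 449 1 init ltac:(lia) dominated_init run_init); try lia.
- rewrite (proj2 (Nat.odd_spec n) hpar). exact hs.
- rewrite <- Nat.negb_even, (proj2 (Nat.even_spec n) hpar). exact hs.
Qed.
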